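(* Let $r \geq 3$ be a fixed integer, let $p = p(n) \in [0,1]$, and let $d = d(n) = (n-(r-1))p$. If $d = \Theta(1)$, then with high probability $$\nu^{(r-1)}(H_r(n,p)) > (1+o(1))\,\frac{1}{r}\,\alpha_r(d)\binom{n}{r-1},$$ where $$\alpha_r(d) = 1 - \left(\frac{1}{(r-1)d+1}\right)^{1/(r-1)}.$$
   Context: An $r$-graph $G$ is a set of $r$-element subsets (edges) of a vertex set $V(G)$. An $(r-1)$-matching in $G$ is a set of edges of $G$ any two distinct members of which intersect in fewer than $r-1$ vertices; $\nu^{(r-1)}(G)$ is the maximum size of an $(r-1)$-matching in $G$. $H_r(n,p)$ denotes the random $r$-graph on a set $V$ of $n$ labelled vertices in which each $r$-element subset of $V$ is an edge with probability $p$, independently of the others; $d$ is the expected number of edges containing a given $(r-1)$-set. $d = \Theta(1)$ means that $d$ is bounded above and bounded away from $0$ by positive constants for all large $n$. ''With high probability'' means with probability tending to $1$ as $n \to \infty$; here $o(1)$ denotes a deterministic quantity tending to $0$ as $n \to \infty$. *)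

(* Defs.v *)
From HB Require Import structures.
From mathcomp Require Import all_boot all_order all_algebra.
From mathcomp Require Import all_classical all_reals all_analysis.

Set Implicit Arguments.
Unset Strict Implicit.
Unset Printing Implicit Defensive.

Import Order.TTheory GRing.Theory Num.Theory.
Import numFieldNormedType.Exports.

Local Open Scope classical_set_scope.
Local Open Scope ring_scope.

Definition is_rgraph (V : finType) (r : nat) (G : {set {set V}}) : bool :=
  [forall e in G, #|e| == r].

Definition is_kmatching (V : finType) (k : nat) (G M : {set {set V}}) : bool :=
  (M \subset G) &&
  [forall e in M, forall f in M, (e != f) ==> (#|e :&: f| < k)%N].

Definition nu (V : finType) (k : nat) (G : {set {set V}}) : nat :=
  (\max_(M : {set {set V}} | is_kmatching k G M) #|M|)%N.

(* The law of H_r(n,p) with vertex set 'I_n: the r-subsets of 'I_n are edges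
   independently, each with probability p. *)
Definition H_mass (R : realType) (r n : nat) (p : R)
    (G : {set {set 'I_n}}) : R :=
  \prod_(e : {set 'I_n} | #|e| == r) (if e \in G then p else 1 - p).

Definition H_prob (R : realType) (r n : nat) (p : R)
    (A : pred {set {set 'I_n}}) : R :=
  \sum_(G : {set {set 'I_n}} | is_rgraph r G && A G) H_mass r p G.

(* The subtraction is taken in R, so the value is meaningful only for
   n >= r - 1. *)
Definition avg_codegree (R : realType) (r n : nat) (p : R) : R :=
  (n%:R - r.-1%:R) * p.

Definition Theta1 (R : realType) (d : nat -> R) : Prop :=
  exists c C : R, [/\ 0 < c, 0 < C & \forall n \near \oo, c <= d n <= C].

Definition alpha (R : realType) (r : nat) (d : R) : R :=
  1 - (1 / (r.-1%:R * d + 1)) `^ (1 / r.-1%:R).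

(* Main.v *)
Require Import Defs.
From HB Require Import structures.
From mathcomp Require Import all_boot all_order all_algebra.
From mathcomp Require Import all_classical all_reals all_analysis.
From mathcomp Require Import fintype finset.
From mathcomp Require Import ring lra zify.

Set Implicit Arguments.
Unset Strict Implicit.
Unset Printing Implicit Defensive.

Import Order.TTheory GRing.Theory Num.Theory.
Import numFieldNormedType.Exports.

Local Open Scope ring_scope.

(** Call an (r-1)-subset of the vertex set a point, and attach to every r-set
    the r points that it contains, its shadow.  The r-sets become the edges of
    a hypergraph on N = 'C(n, r-1) points which is r-uniform, D-regular with
    D = n - r + 1, and linear: two distinct points lie in at most one common
    edge.  An (r-1)-matching is a matching of this hypergraph, so the claim is
    that a random set of edges of density p contains a matching that covers
    almost a proportion alpha_r(d) of the points, where d = D p.  The greedy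
    matching does it.

    Draw the C = 'C(n, r) edges one after the other in a uniformly random
    order, and select an edge when it is disjoint from the edges selected
    before.  Let f_m(A) be the probability that no point of the set A is covered
    after m draws.  An edge none of whose points is covered cannot have been
    drawn yet (otherwise it would have been selected), which gives an exact
    identity, [survivalS]:

      f_(m+1)(A) = f_m(A) - 1/(C - m) sum_(e meets A) f_m(A u shadow e).

    By regularity and linearity, all but O(|A|^2) of the D |A| incidences of A
    with edges come from edges that meet A in one point only, and then A u shadow e
    has |A| + r - 1 points.  To first order the identity therefore becomes the
    hierarchy g_a' = - a g_(a+r-1), which is solved by g_a = y^a with
    y' = - y^r, that is y(t) = (1 + (r-1) t)^(-1/(r-1)), and 1 - y(d) is
    alpha_r(d).  No independence has to be proved: it is part of the conclusion
    f(A) ~ y^|A|.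

    What needs an argument is that the hierarchy does not amplify the error
    terms.  If the deviation of f_m(A) from y^|A| is at most eps 2^|A| at some
    time, then it stays below eps lam^|A| with lam growing linearly in time
    ([survival_step]), hence below eps 4^|A| during a time window of constant
    length.  The deviation is also at most 1, and
    min(eps 4^a, 1) <= sqrt(eps) 2^a, so the argument restarts with sqrt(eps) in
    place of eps ([survival_close]).  The total time, about d, is bounded, so a
    bounded number of windows suffices, and a bounded number of square roots of
    a quantity O(1/n) still tends to 0.

    The sets A with one and two points control the mean and the variance of the
    number of uncovered points, and Chebyshev's inequality gives the size of the
    greedy matching ([greedy_matching_large]).  Finally, H_r(n,p) given its
    number of edges m is distributed as the first m edges of the random order,
    its number of edges is at least (1 - delta) p C with high probability, and
    the greedy matching grows with the number of draws
    ([random_subset_lower]). *)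

(** * Edges in a uniformly random order *)

Section RandomOrder.
Variables (R : realFieldType) (E : finType) (U : {set E}).
Implicit Types (F : seq E -> R) (w : seq E) (m : nat).

(** The mean of F over the first m terms of a uniformly random order of U, the
    latest term at the head of the sequence.  Each step averages over the terms
    that are still available; the recursion replaces a sum over injective
    m-tuples. *)
Fixpoint expect m F : R :=
  if m is k.+1 then
    expect k (fun w => (#|U|%:R - k%:R)^-1 *
                       \sum_(e in U | e \notin w) F (e :: w))
  else F [::].

Definition is_draw m w := [&& uniq w, all (mem U) w & size w == m].

Lemma is_draw_cons m e w :
  is_draw m w -> e \in U -> e \notin w -> is_draw m.+1 (e :: w).
Proof.
by case/and3P=> uw aw /eqP <- eU ew; rewrite /is_draw /= uw ew aw eU eqxx.
Qed.

Lemma card_undrawn m w : is_draw m w -> #|[pred e in U | e \notin w]| = (#|U| - m)%N.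
Proof.
case/and3P=> uw /allP aw /eqP sw.
have -> : #|[pred e in U | e \notin w]| = #|U :\: [set e in w]|.
  by apply: eq_card => e; rewrite !inE andbC.
rewrite cardsD -sw -(card_uniqP uw); congr (_ - _)%N.
apply: eq_card => e; rewrite !inE; apply: andb_idl; exact: aw.
Qed.

Lemma eq_expect m F1 F2 :
  (forall w, is_draw m w -> F1 w = F2 w) -> expect m F1 = expect m F2.
Proof.
elim: m F1 F2 => [|m IHm] F1 F2 eqF /=; first exact: eqF.
apply: IHm => w dw; congr (_ * _); apply: eq_bigr => e /andP[eU ew].
by apply: eqF; apply: is_draw_cons.
Qed.

Lemma expect_le m F1 F2 : (m <= #|U|)%N ->
  (forall w, is_draw m w -> F1 w <= F2 w) -> expect m F1 <= expect m F2.
Proof.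
elim: m F1 F2 => [|m IHm] F1 F2 lm leF /=; first exact: leF.
apply: IHm => [|w dw]; first exact: ltnW.
apply: ler_wpM2l; first by rewrite invr_ge0 subr_ge0 ler_nat ltnW.
by apply: ler_sum => e /andP[eU ew]; apply: leF; apply: is_draw_cons.
Qed.

Lemma expect_cst m (c : R) : (m <= #|U|)%N -> expect m (fun=> c) = c.
Proof.
elim: m => [//|m IHm] lm /=; rewrite -[RHS]IHm; last exact: ltnW.
apply: eq_expect => w dw; rewrite sumr_const (card_undrawn dw) -natrB 1?ltnW //.
by rewrite -[c *+ _]mulr_natl mulKf // pnatr_eq0 -lt0n subn_gt0.
Qed.

Lemma expect_sum (I : Type) (r : seq I) (P : pred I) m (F : I -> seq E -> R) :
  expect m (fun w => \sum_(i <- r | P i) F i w) = \sum_(i <- r | P i) expect m (F i).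
Proof.
elim: m F => [//|m IHm] F /=; rewrite -IHm; apply: eq_expect => w _.
by rewrite exchange_big /= mulr_sumr.
Qed.

Lemma expectZ m (c : R) F : expect m (fun w => c * F w) = c * expect m F.
Proof.
elim: m F => [//|m IHm] F /=; rewrite -IHm; apply: eq_expect => w _.
by rewrite -mulr_sumr mulrCA.
Qed.

Lemma expectD m F1 F2 :
  expect m (fun w => F1 w + F2 w) = expect m F1 + expect m F2.
Proof.
elim: m F1 F2 => [//|m IHm] F1 F2 /=; rewrite -IHm; apply: eq_expect => w _.
by rewrite big_split mulrDr.
Qed.

Lemma expect_ge0 m F : (m <= #|U|)%N -> (forall w, 0 <= F w) -> 0 <= expect m F.
Proof.
by move=> lm F0; rewrite -(expect_cst 0 lm); apply: expect_le.
Qed.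

(** Both sides count pairs of a set of size m + 1 and one of its elements, the
    element that is added last. *)
Lemma sum_card_succ m (phi : {set E} -> R) :
  \sum_(G : {set E} | (G \subset U) && (#|G| == m))
     \sum_(e in U | e \notin G) phi (e |: G) =
  m.+1%:R * \sum_(G : {set E} | (G \subset U) && (#|G| == m.+1)) phi G.
Proof.
transitivity (\sum_(G : {set E} | (G \subset U) && (#|G| == m.+1))
                \sum_(e in G) phi G); last first.
  rewrite mulr_sumr; apply: eq_bigr => G /andP[_ /eqP cG].
  by rewrite sumr_const cG mulr_natl.
rewrite (exchange_big_dep (mem U)) /=; last by move=> G e _ /andP[].
rewrite [RHS](exchange_big_dep (mem U)) /=; last first.
  by move=> G e /andP[/subsetP GU _] /GU.
apply: eq_bigr => e eU.
rewrite [RHS](reindex_onto (fun G => e |: G) (fun G => G :\ e)) /=; last first.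
  by move=> G /andP[_ eG]; rewrite setD1K.
apply: eq_bigl => G; rewrite subUset sub1set eU setU11 /= cardsU1.
case: (boolP (e \in G)) => eG /=.
  rewrite !andbF; apply/esym/negP=> /andP[_ /eqP GE].
  by move: eG; rewrite -GE !inE eqxx.
by rewrite eqSS setU1K // eqxx !andbT.
Qed.

(** The set of the first m terms of a random order is a uniform m-subset. *)
Lemma expect_set m (phi : {set E} -> R) : (m <= #|U|)%N ->
  'C(#|U|, m)%:R * expect m (fun w => phi [set e in w]) =
  \sum_(G : {set E} | (G \subset U) && (#|G| == m)) phi G.
Proof.
elim: m phi => [|m IHm] phi lm /=.
  rewrite bin0 mul1r (big_pred1 set0); first by congr phi; apply/setP=> e; rewrite !inE.
  move=> G; rewrite /= cards_eq0; apply/andP/eqP => [[_ /eqP]//|->].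
  by rewrite sub0set eqxx.
pose psi (G : {set E}) := (#|U|%:R - m%:R)^-1 * \sum_(e in U | e \notin G) phi (e |: G).
have -> : expect m (fun w => (#|U|%:R - m%:R)^-1 *
    (\sum_(e in U | e \notin w) phi [set e0 in e :: w])) =
    expect m (fun w => psi [set e in w]).
  apply: eq_expect => w _; rewrite /psi; congr (_ * _).
  apply: eq_big => [e|e _]; first by rewrite inE.
  by congr phi; apply/setP=> f; rewrite !inE.
have m1_neq0 : (m.+1%:R : R) != 0 by rewrite pnatr_eq0.
have Cm0 : (#|U|%:R - m%:R : R) != 0 by rewrite -natrB 1?ltnW // pnatr_eq0 -lt0n subn_gt0.
apply: (mulfI m1_neq0); rewrite -sum_card_succ mulrA -natrM mul_bin_left natrM natrB 1?ltnW //.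
rewrite -mulrA IHm 1?ltnW // mulr_sumr; apply: eq_bigr => G _.
by rewrite /psi mulVKf.
Qed.

Lemma expect_monoS m F : (m < #|U|)%N ->
  (forall e w, F w <= F (e :: w)) -> expect m F <= expect m.+1 F.
Proof.
move=> lm monoF /=; apply: expect_le => [|w dw]; first exact: ltnW.
have Cm0 : 0 < #|U|%:R - m%:R :> R by rewrite subr_gt0 ltr_nat.
rewrite mulrC ler_pdivlMr // -natrB 1?ltnW // -(card_undrawn dw) mulr_natr -sumr_const.
exact: ler_sum.
Qed.

Lemma expect_mono m m' F : (m <= m' <= #|U|)%N ->
  (forall e w, F w <= F (e :: w)) -> expect m F <= expect m' F.
Proof.
move=> /andP[mm' mU] monoF; elim: m' mm' mU => [|m' IHm].
  by rewrite leqn0 => /eqP->.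
rewrite leq_eqVlt => /predU1P[->//|mm'] mU.
apply: le_trans (IHm mm' (ltnW mU)) _; exact: expect_monoS.
Qed.

End RandomOrder.

(** * The binomial distribution *)

Section Binomial.
Variables (R : realFieldType) (p : R).

(** The mean of phi under the binomial law with parameters n and p. *)
Definition binomial_mean (n : nat) (phi : nat -> R) : R :=
  \sum_(m < n.+1) 'C(n, m)%:R * (p ^+ m * (1 - p) ^+ (n - m)) * phi m.

(** Conditioning on the last of n + 1 independent trials; it turns the moment
    computations below into inductions on n. *)
Lemma binomial_meanS n phi :
  binomial_mean n.+1 phi =
  p * binomial_mean n (fun m => phi m.+1) + (1 - p) * binomial_mean n phi.
Proof.
rewrite /binomial_mean big_ord_recl /= !mulr_sumr bin0.
have -> : \sum_(i < n.+1) (1 - p) * ('C(n, i)%:R * (p ^+ i * (1 - p) ^+ (n - i)) * phi i)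
  = (1 - p) ^+ n.+1 * phi 0%N + \sum_(i < n.+1)
      (1 - p) * ('C(n, i.+1)%:R * (p ^+ i.+1 * (1 - p) ^+ (n - i.+1)) * phi i.+1).
  rewrite [in RHS]big_ord_recr /= bin_small // mul0r mul0r mulr0 addr0.
  by rewrite big_ord_recl /= bin0 subn0 expr0 exprS; congr (_ + _); ring.
rewrite addrCA; congr (_ + _); first by rewrite subn0; ring.
rewrite -big_split /=; apply: eq_bigr => i _.
rewrite /bump /= add1n binS natrD subSS exprS.
case: (ltnP i n) => [lin|]; last by move=> lni; rewrite (@bin_small n i.+1) //; ring.
by rewrite -{2}[(n - i)%N]prednK ?subn_gt0 // -subnS exprS -subnSK // exprS; ring.
Qed.

Lemma binomial_mean1 n : binomial_mean n (fun=> 1) = 1.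
Proof.
elim: n => [|n IHn]; last by rewrite binomial_meanS IHn; ring.
by rewrite /binomial_mean big_ord1 /= bin0 expr0; ring.
Qed.

(** The centre a is arbitrary because one more successful trial shifts it;
    a = n p gives the variance. *)
Lemma binomial_mean_sqr n a :
  binomial_mean n (fun m => (m%:R - a) ^+ 2) =
  n%:R * p * (1 - p) + (n%:R * p - a) ^+ 2.
Proof.
elim: n a => [|n IHn] a.
  by rewrite /binomial_mean big_ord1 /= bin0 expr0; ring.
rewrite binomial_meanS IHn.
have -> : binomial_mean n (fun m => (m.+1%:R - a) ^+ 2) =
          binomial_mean n (fun m => (m%:R - (a - 1)) ^+ 2).
  by apply: eq_bigr => m _; rewrite -natr1; congr (_ * _); ring.
by rewrite IHn -natr1; ring.
Qed.

Hypothesis p01 : 0 <= p <= 1.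

Lemma binomial_mean_le n phi psi :
  (forall m : nat, (m <= n)%N -> phi m <= psi m) ->
  binomial_mean n phi <= binomial_mean n psi.
Proof.
case/andP: p01 => p0 p1 le_pp; apply: ler_sum => m _; apply: ler_wpM2l; last by apply: le_pp; rewrite -ltnS.
by rewrite mulr_ge0 // mulr_ge0 // exprn_ge0 // subr_ge0.
Qed.

(** Chebyshev's inequality.  The factor b is carried along so that the bound can
    be compared with the mean of a function that is at least b from I on. *)
Lemma binomial_lower_tail n I (b t : R) : 0 < t -> 0 <= b <= 1 ->
  I%:R <= n%:R * p - t ->
  b - n%:R * p / t ^+ 2 <= binomial_mean n (fun m => b *+ (I <= m)%N).
Proof.
move=> t0 /andP[b0 b1] It.
have p0 : 0 <= p by case/andP: p01.
have np0 : 0 <= n%:R * p by rewrite mulr_ge0.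
have t20 : 0 < t ^+ 2 by rewrite exprn_gt0.
have : binomial_mean n (fun m => b - (m%:R - n%:R * p) ^+ 2 / t ^+ 2) <=
       binomial_mean n (fun m => b *+ (I <= m)%N).
  apply: binomial_mean_le => m _; case: leqP => [_|mI].
    by rewrite mulr1n gerBl divr_ge0 // ?sqr_ge0 // ltW.
  rewrite mulr0n subr_le0; apply: le_trans b1 _; rewrite ler_pdivlMr // mul1r.
  have : (m%:R : R) < I%:R by rewrite ltr_nat.
  rewrite -[X in _ <= X]sqrrN => ltmI; apply: lerXn2r; rewrite ?nnegrE; lra.
apply: le_trans.
have -> : binomial_mean n (fun m => b - (m%:R - n%:R * p) ^+ 2 / t ^+ 2) =
   b * binomial_mean n (fun=> 1) - binomial_mean n (fun m => (m%:R - n%:R * p) ^+ 2) / t ^+ 2.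
  by rewrite /binomial_mean mulr_sumr mulr_suml -sumrB; apply: eq_bigr => m _; ring.
rewrite binomial_mean1 binomial_mean_sqr mulr1 subrr expr0n addr0 lerD2l lerN2.
by rewrite ler_pM2r ?invr_gt0 // ler_piMr //; lra.
Qed.

End Binomial.

(** * Bernoulli inequalities and iterated square roots *)

Section Bernoulli.
Variable R : realFieldType.
Implicit Types (u x a : R) (m : nat).

Lemma bernoulli_ge u m : 0 <= u <= 1 -> 1 - m%:R * u <= (1 - u) ^+ m.
Proof.
move=> u01; elim: m => [|m IHm]; first by rewrite expr0; lra.
have m0 : 0 <= m%:R :> R by rewrite ler0n.
by rewrite exprS -natr1; nra.
Qed.

Lemma bernoulli_le u m : 0 <= u <= 1 ->
  (1 - u) ^+ m <= 1 - m%:R * u + m%:R ^+ 2 * u ^+ 2.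
Proof.
move=> /andP[u0 u1]; elim: m => [|m IHm]; first by rewrite expr0; lra.
have m0 : 0 <= m%:R :> R by rewrite ler0n.
rewrite exprS -natr1.
have : (1 - u) * (1 - u) ^+ m <= (1 - u) * (1 - m%:R * u + m%:R ^+ 2 * u ^+ 2).
  by apply: ler_wpM2l => //; lra.
have : 0 <= m%:R * u ^+ 2 by rewrite mulr_ge0 // sqr_ge0.
have : 0 <= m%:R ^+ 2 * u ^+ 3 by rewrite mulr_ge0 ?sqr_ge0 // exprn_ge0.
by have := sqr_ge0 u; lra.
Qed.

Lemma expr_add_ge x a m : 0 <= x -> 0 <= a ->
  x ^+ m.+1 + m.+1%:R * a * x ^+ m <= (x + a) ^+ m.+1.
Proof.
move=> x0 a0; elim: m => [|m IHm]; first by rewrite expr1 expr0; lra.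
rewrite [(x + a) ^+ _]exprS.
have : (x + a) * (x ^+ m.+1 + m.+1%:R * a * x ^+ m) <= (x + a) * (x + a) ^+ m.+1.
  by apply: ler_wpM2l => //; lra.
apply: le_trans; rewrite -[m.+2%:R]natr1 !exprS.
have : 0 <= m.+1%:R * a ^+ 2 * x ^+ m by rewrite !mulr_ge0 ?sqr_ge0 ?exprn_ge0.
by lra.
Qed.

End Bernoulli.
Section IteratedSqrt.
Variable R : rcfType.

(** The factor of a geometric error bound after k restarts; see
    [survival_close]. *)
Definition root_iter (k : nat) (x : R) : R := iter k Num.sqrt x.

Lemma root_iter_bounds k (x : R) : 0 <= x <= 1 -> x <= root_iter k x <= 1.
Proof.
move=> /andP[x0 x1]; elim: k => [|k /andP[IH1 IH2]]; first by rewrite /= lexx x1.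
set z := root_iter k x in IH1 IH2; rewrite /root_iter iterS -/(root_iter k x) -/z.
have z0 : 0 <= z by lra.
have s0 := sqrtr_ge0 z; have sz := sqr_sqrtr z0.
have s1 : Num.sqrt z <= 1 by rewrite -sqrtr1 ler_wsqrtr.
rewrite s1 andbT (le_trans IH1) // -[leLHS]sz expr2; exact: ler_piMl.
Qed.

Lemma root_iter_le k (x y : R) : x <= y -> root_iter k x <= root_iter k y.
Proof.
by move=> xy; elim: k => [//|k IHk]; rewrite /root_iter !iterS ler_wsqrtr.
Qed.

End IteratedSqrt.

(** * The greedy matching of a linear hypergraph *)

Section Greedy.
Variables (S E : finType) (W : {set S}) (U : {set E}) (bd : E -> {set S}).
Variables (r D : nat).
Hypothesis r_gt0 : (0 < r)%N.
Hypothesis bd_sub : forall e, e \in U -> bd e \subset W.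
Hypothesis card_bd : forall e, e \in U -> #|bd e| = r.
Hypothesis degreeD : forall s, s \in W -> #|[set e in U | s \in bd e]| = D.
Hypothesis codegree1 : forall s t, s != t ->
  (#|[set e in U | (s \in bd e) && (t \in bd e)]| <= 1)%N.

Definition covered (M : {set E}) : {set S} := \bigcup_(e in M) bd e.

Fixpoint greedy (w : seq E) : {set E} :=
  if w is e :: w' then
    if [disjoint bd e & covered (greedy w')] then e |: greedy w' else greedy w'
  else finset.set0.

(** The points of A are all still uncovered. *)
Definition alive (A : {set S}) (w : seq E) := [disjoint A & covered (greedy w)].

Lemma covered_setU1 e M : covered (e |: M) = bd e :|: covered M.
Proof. by rewrite /covered bigcup_setU big_set1. Qed.

Lemma alive0 w : alive finset.set0 w.
Proof. by rewrite /alive -setI_eq0 set0I. Qed.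

Lemma alive_nil A : alive A [::].
Proof. by rewrite /alive /covered big_set0 -setI_eq0 setI0. Qed.

Lemma aliveU A B w : alive (A :|: B) w = alive A w && alive B w.
Proof. by rewrite /alive -!setI_eq0 setIUl setU_eq0. Qed.

(** A set of uncovered points is hit exactly when the new edge is selected,
    that is when its points are all uncovered, and meets the set. *)
Lemma alive_cons A e w :
  alive A (e :: w) = alive A w && ~~ (alive (bd e) w && ~~ [disjoint A & bd e]).
Proof.
rewrite {1}/alive /=; rewrite -[[disjoint bd e & _]]/(alive (bd e) w).
case: (alive (bd e) w) => /=; last by rewrite andbT.
by rewrite [alive A w]/alive covered_setU1 negbK andbC -!setI_eq0 setIUr setU_eq0.
Qed.

Lemma greedy_sub w : greedy w \subset [set e in w].
Proof.
elim: w => [|e w IHw] /=; first by rewrite sub0set.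
have sub : [set e in w] \subset [set f in e :: w].
  by apply/subsetP=> f; rewrite !inE => ->; rewrite orbT.
case: ifP => _; last exact: subset_trans IHw sub.
by rewrite subUset sub1set inE mem_head (subset_trans IHw sub).
Qed.

(** When an edge is drawn, either it is selected or it already meets a selected
    edge.  This makes the recursion for survival probabilities exact: no
    information about which edges were drawn and rejected is needed. *)
Lemma drawn_dead w e : e \in w -> e \in U -> ~~ alive (bd e) w.
Proof.
move=> + eU; elim: w => [//|f w IHw]; rewrite inE alive_cons negb_and.
case: eqVneq => [<- _|_ /= /IHw->//]; case: (alive (bd e) w) => //=.
by rewrite negbK -setI_eq0 setIid -cards_eq0 card_bd // -lt0n.
Qed.

Lemma covered_greedy_sub w : all (mem U) w -> covered (greedy w) \subset W.
Proof.
move/allP=> wU; apply/bigcupsP=> e /(subsetP (greedy_sub w)); rewrite inE => /wU.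
exact: bd_sub.
Qed.

Lemma card_covered w : all (mem U) w -> #|covered (greedy w)| = (r * #|greedy w|)%N.
Proof.
elim: w => [|e w IHw] /=; first by rewrite /covered big_set0 !cards0 muln0.
case/andP=> eU wU; case: ifP => [dis|_]; last exact: IHw.
rewrite covered_setU1 cardsU (disjoint_setI0 dis) cards0 subn0 IHw // card_bd //.
rewrite cardsU1; suff -> : e \notin greedy w by rewrite mulnDr muln1.
apply/negP=> eM; have : bd e \subset covered (greedy w) by apply: bigcup_sup.
move/setIidPl; rewrite (disjoint_setI0 dis) => /eqP.
by rewrite eq_sym -cards_eq0 card_bd // -leqn0 leqNgt r_gt0.
Qed.

Lemma greedy_disjoint w e f : e \in greedy w -> f \in greedy w -> e != f ->
  [disjoint bd e & bd f].
Proof.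
elim: w => [|g w IHw] /=; first by rewrite inE.
case: ifP => [dis|_]; last exact: IHw.
have disP h : h \in greedy w -> [disjoint bd g & bd h].
  by move=> hM; apply: disjointWr dis; apply: bigcup_sup.
rewrite !inE => /predU1P[->|eM] /predU1P[->|fM]; first by rewrite eqxx.
- by move=> _; apply: disP.
- by rewrite disjoint_sym => _; apply: disP.
exact: IHw.
Qed.

Lemma greedy_cons_card e w : (#|greedy w| <= #|greedy (e :: w)|)%N.
Proof. by rewrite /=; case: ifP => // _; rewrite cardsU1 leq_addl. Qed.

Lemma sum_touching (A : {set S}) : A \subset W ->
  (\sum_(e in U) #|bd e :&: A| = #|A| * D)%N.
Proof.
move=> AW; transitivity (\sum_(e in U) \sum_(s in A) (s \in bd e))%N.
  apply: eq_bigr => e _; rewrite -sum1_card big_mkcond /= [RHS]big_mkcond /=.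
  by apply: eq_bigr => s _; rewrite inE; case: (s \in bd e); case: (s \in A).
rewrite exchange_big /= -sum_nat_const; apply: eq_bigr => s sA.
rewrite -(degreeD (subsetP AW _ sA)) -sum1_card big_mkcond /= [RHS]big_mkcond /=.
by apply: eq_bigr => e _; rewrite inE; case: (e \in U); case: (s \in bd e).
Qed.

(** By linearity, an ordered pair of points of A determines at most one edge, and
    an edge with k > 1 points in A contains k (k - 1) >= k such pairs. *)
Lemma sum_touching_twice (A : {set S}) :
  (\sum_(e in U | (1 < #|bd e :&: A|)%N) #|bd e :&: A| <= #|A| ^ 2)%N.
Proof.
apply: leq_trans (_ : \sum_(e in U)
  #|[set u in setX A A | [&& u.1 != u.2, u.1 \in bd e & u.2 \in bd e]]| <= _)%N; last first.
  apply: leq_trans (_ : \sum_(u in setX A A) 1 <= _)%N; last by rewrite sum1_card cardsX.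
  rewrite (eq_bigr (fun e => \sum_(u in setX A A)
    [&& u.1 != u.2, u.1 \in bd e & u.2 \in bd e] : nat)%N); last first.
    move=> e _; rewrite -sum1_card big_mkcond /= [RHS]big_mkcond /=.
    by apply: eq_bigr => u _; rewrite !inE; case: ((u.1 \in A) && _) => //=; case: ([&& _, _ & _]).
  rewrite exchange_big /=; apply: leq_sum => -[s t] _ /=.
  case: (eqVneq s t) => [_|nst] /=; first by rewrite big1.
  apply: leq_trans (codegree1 nst); rewrite -sum1_card big_mkcond /= [leqRHS]big_mkcond /=.
  by apply: leq_sum => e _; rewrite inE; case: (e \in U); case: (_ && _).
rewrite [leqRHS](bigID (fun e => 1 < #|bd e :&: A|)%N) /= -[leqLHS]addn0; apply: leq_add => //.
apply: leq_sum => e /andP[eU lt1].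
have /card_gt1P[s [t [sB tB nst]]] := lt1.
set B := bd e :&: A in sB tB lt1 *.
(* Pairing each point of B with another one embeds B into the ordered pairs. *)
pose other x := if x == s then t else s.
apply: leq_trans (_ : #|[set (x, other x) | x in B]| <= _)%N.
  by rewrite card_imset // => x y [].
apply: subset_leq_card; apply/subsetP=> _ /imsetP[x xB ->].
move: sB tB xB; rewrite !inE /= /other => /andP[se sA] /andP[te tA] /andP[xe xA].
by rewrite xe xA; case: (eqVneq x s) => [->|nxs] /=; rewrite ?te ?tA ?nst ?nxs ?se ?sA.
Qed.

Section Survival.
Variable R : realFieldType.

Definition survival m (A : {set S}) : R := expect U m (fun w => (alive A w)%:R).

Lemma survival_ge0 m A : (m <= #|U|)%N -> 0 <= survival m A.
Proof. by move=> lm; apply: expect_ge0 => // w; rewrite ler0n. Qed.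

Lemma survival_le1 m A : (m <= #|U|)%N -> survival m A <= 1.
Proof.
move=> lm; rewrite -[leRHS](expect_cst 1 lm); apply: expect_le => // w _.
by rewrite lern1 leq_b1.
Qed.

Lemma survival_set0 m : (m <= #|U|)%N -> survival m finset.set0 = 1.
Proof.
move=> lm; rewrite -[RHS](expect_cst 1 lm); apply: eq_expect => w _.
by rewrite alive0.
Qed.

Lemma survival_start A : survival 0 A = 1.
Proof. by rewrite /survival /= alive_nil. Qed.

(** The points of A survive the next draw unless it selects an edge e that meets
    A; this has probability 1/(C - m) given that A and the points of e are
    uncovered, since e is then undrawn by [drawn_dead]. *)
Lemma survivalS m A : (m < #|U|)%N ->
  survival m.+1 A = survival m A -
    (#|U|%:R - m%:R)^-1 *
      \sum_(e in U | ~~ [disjoint A & bd e]) survival m (A :|: bd e).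
Proof.
move=> lm; rewrite /survival.
transitivity (expect U m (fun w => (alive A w)%:R + (-1) * ((#|U|%:R - m%:R)^-1 *
    \sum_(e in U | ~~ [disjoint A & bd e]) ((alive (A :|: bd e) w)%:R : R)))); last first.
  by rewrite expectD !expectZ expect_sum mulN1r.
rewrite [LHS]/=; apply: eq_expect => w dw; have /and3P[_ wU _] := dw.
have Cm0 : (#|U|%:R - m%:R : R) != 0.
  by rewrite -natrB 1?ltnW // pnatr_eq0 -lt0n subn_gt0.
apply: (mulfI Cm0); rewrite mulVKf // mulrDr mulN1r mulrN mulVKf //.
transitivity (\sum_(e in U | e \notin w) ((alive A w)%:R -
   (~~ [disjoint A & bd e])%:R * (alive (A :|: bd e) w)%:R) : R).
  apply: eq_bigr => e _; rewrite alive_cons aliveU.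
  case: (alive A w); case: (alive _ w); case: [disjoint _ & _];
  by rewrite /= ?mulr0 ?mul0r ?mulr1 ?subrr ?subr0.
rewrite sumrB sumr_const (card_undrawn dw).
rewrite -natrB 1?ltnW // mulr_natl; congr (_ - _).
rewrite [LHS]big_mkcondr [RHS]big_mkcondr /=; apply: eq_bigr => e eU.
case: ifPn => [_|]; first by case: ifP => _; rewrite ?mul1r ?mul0r.
rewrite negbK => /drawn_dead/(_ eU); rewrite aliveU => /negbTE->.
by rewrite andbF; case: ifP.
Qed.

End Survival.
End Greedy.

(** * Stability of the survival hierarchy *)

Section Stability.
Variables (S E : finType) (W : {set S}) (U : {set E}) (bd : E -> {set S}).
Variables (r D : nat).
Hypothesis r_gt0 : (0 < r)%N.
Hypothesis bd_sub : forall e, e \in U -> bd e \subset W.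
Hypothesis card_bd : forall e, e \in U -> #|bd e| = r.
Hypothesis degreeD : forall s, s \in W -> #|[set e in U | s \in bd e]| = D.
Hypothesis codegree1 : forall s t, s != t ->
  (#|[set e in U | (s \in bd e) && (t \in bd e)]| <= 1)%N.
Variable R : rcfType.
Local Notation survival := (survival U bd R).

(** The sum in [survivalS] is compared with D |A| y^(|A|+r-1): an edge that meets A
    once adds r - 1 points, and the few edges that meet A more often are
    estimated trivially. *)
Lemma touching_average (g : {set S} -> R) (y delta : R) (A : {set S}) :
  (forall B, 0 <= g B <= 1) -> 0 <= y <= 1 -> 0 <= delta -> A \subset W ->
  (forall e, e \in U -> #|A :|: bd e| = (#|A| + r).-1 ->
    `|g (A :|: bd e) - y ^+ (#|A| + r).-1| <= delta) ->
  `|\sum_(e in U | ~~ [disjoint A & bd e]) g (A :|: bd e)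
    - #|A|%:R * D%:R * y ^+ (#|A| + r).-1| <= #|A|%:R * D%:R * delta + #|A|%:R ^+ 2.
Proof.
move=> g01 y01 d0 AW close; set z := y ^+ _ in close *.
have z01 : 0 <= z <= 1 by rewrite exprn_ge0 ?exprn_ile1 //; case/andP: y01.
pose k e : R := #|bd e :&: A|%:R.
have sumk : #|A|%:R * D%:R = \sum_(e in U) k e.
  by rewrite -natrM -(sum_touching degreeD AW) natr_sum.
have sumk2 : \sum_(e in U | (1 < #|bd e :&: A|)%N) k e <= #|A|%:R ^+ 2.
  by rewrite -natrX -natr_sum ler_nat; exact: sum_touching_twice codegree1 A.
apply: le_trans (lerD (lexx _) sumk2).
rewrite sumk !mulr_suml big_mkcondr [in leRHS]big_mkcondr /= -sumrB -big_split /=.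
apply: le_trans (ler_norm_sum _ _ _) _; apply: ler_sum => e eU; rewrite /k.
rewrite -setI_eq0 -cards_eq0 setIC.
(* An edge contributes according to its number of points in A: 0, 1 or more. *)
have [->|k_gt0] := posnP #|bd e :&: A|.
  by rewrite /= !mul0r subrr normr0 addr0.
rewrite /=; have [lt1|le1] := ltnP 1 #|bd e :&: A|; last first.
  have k1 : #|bd e :&: A| = 1%N by apply/eqP; rewrite eqn_leq le1.
  rewrite k1 !mul1r addr0; apply: close => //.
  by rewrite cardsU setIC k1 card_bd // subn1.
have /andP[g0 g1] := g01 (A :|: bd e); case/andP: z01 => z0 z1.
have : 1 <= #|bd e :&: A|%:R :> R by rewrite ler1n ltnW.
set x := _%:R => x1.
have xz0 : 0 <= x * z by rewrite mulr_ge0 //; lra.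
have xz1 : x * z <= x by rewrite ler_piMr //; lra.
have xd0 : 0 <= x * delta by rewrite mulr_ge0 //; lra.
by rewrite ler_norml; lra.
Qed.

(** Euler's scheme for y' = - y^r, with the step sizes D / (C - j) at which the
    random order consumes edges. *)
Fixpoint euler (i : nat) : R :=
  if i is j.+1 then euler j - D%:R / (#|U|%:R - j%:R) * euler j ^+ r else 1.

Variables (I : nat) (H : R).
Hypothesis D_gt0 : (0 < D)%N.
Hypothesis I_le : (I <= #|U|)%N.
Hypothesis rateH : forall i, (i < I)%N -> D%:R / (#|U|%:R - i%:R) <= H.
Hypothesis H_le1 : H <= 1.

Lemma rate_ge0 i : (i < I)%N -> 0 <= D%:R / (#|U|%:R - i%:R) :> R.
Proof.
move=> iI; rewrite divr_ge0 // subr_ge0 ler_nat; apply: leq_trans I_le.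
exact: ltnW.
Qed.

Lemma eulerS i : euler i.+1 = euler i * (1 - D%:R / (#|U|%:R - i%:R) * euler i ^+ r.-1).
Proof. by rewrite /= -[X in _ ^+ X](prednK r_gt0) exprS; ring. Qed.

Lemma euler01 i : (i <= I)%N -> 0 <= euler i <= 1.
Proof.
elim: i => [|i IHi] iI; first by rewrite /= lexx ler01.
have /andP[y0 y1] := IHi (ltnW iI); rewrite eulerS.
set u := _ / _ * _; have u0 : 0 <= u by rewrite mulr_ge0 ?rate_ge0 ?exprn_ge0.
have u1 : u <= 1.
  rewrite mulr_ile1 ?rate_ge0 ?exprn_ge0 ?exprn_ile1 //.
  exact: le_trans (rateH iI) H_le1.
by nra.
Qed.

(** The weight lam^a is a barrier for the hierarchy.  Its source term at sets of
    size m involves size m + r - 1, so it is at most of order m lam^(m+r-1),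
    while raising lam by c H with c = 4^r + 1 raises lam^m by at least
    m c H lam^(m-1); since lam <= 4, the part 4^r of c absorbs the source term
    and the part 1 absorbs the errors of order m^2 (1/D + H), because
    m <= 2^(m-1) <= lam^(m-1). *)
Lemma survival_step i (eps lam : R) :
  (i < I)%N -> D%:R^-1 + H <= eps -> 2 <= lam <= 4 ->
  (forall A : {set S}, A \subset W -> `|survival i A - euler i ^+ #|A| | <= eps * lam ^+ #|A|) ->
  forall A : {set S}, A \subset W ->
  `|survival i.+1 A - euler i.+1 ^+ #|A| | <= eps * (lam + (4 ^+ r + 1) * H) ^+ #|A|.
Proof.
move=> iI eps_ge /andP[lam2 lam4] close A AW.
have iU : (i < #|U|)%N := leq_trans iI I_le.
have h0 := rate_ge0 iI; have hH := rateH iI.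
have H0 : 0 <= H := le_trans h0 hH.
have D0 : 0 < D%:R :> R by rewrite ltr0n.
have Dv0 : 0 <= D%:R^-1 :> R by rewrite invr_ge0 ltW.
have e0 : 0 <= eps by lra.
have /andP[y0 y1] := euler01 (ltnW iI).
case: (posnP #|A|) => [/eqP|].
  rewrite cards_eq0 => /eqP->.
  by rewrite !survival_set0 ?cards0 ?expr0 ?subrr ?normr0 ?mulr1 // ltnW.
set m := #|A|; case Em: m => [//|m'] _; rewrite -Em.
set h := D%:R / _ in h0 hH.
have kap : (#|U|%:R - i%:R)^-1 = h / D%:R :> R by rewrite /h mulrAC divff ?mul1r ?lt0r_neq0.
rewrite (survivalS r_gt0 card_bd) // // kap.
have mr : (m + r).-1 = (m + r.-1)%N by rewrite -[in LHS](prednK r_gt0) addnS.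
have avg : `|\sum_(e in U | ~~ [disjoint A & bd e]) survival i (A :|: bd e)
    - m%:R * D%:R * euler i ^+ (m + r).-1| <= m%:R * D%:R * (eps * lam ^+ (m + r).-1) + m%:R ^+ 2.
  apply: touching_average => //.
  - by move=> B; rewrite survival_ge0 ?survival_le1 // ltnW.
  - by rewrite y0 y1.
  - by rewrite mulr_ge0 // exprn_ge0 //; lra.
  by move=> e eU <-; apply: close; rewrite subUset AW bd_sub.
set Sg := \sum_(e in _ | _) _ in avg *.
pose u := h * euler i ^+ r.-1.
have u0 : 0 <= u by rewrite mulr_ge0 // exprn_ge0.
have uh : u <= h by rewrite ler_piMr // exprn_ile1.
have u01 : 0 <= u <= 1 by rewrite u0 (le_trans uh) ?(le_trans hH).
have bl := bernoulli_ge m u01; have bu := bernoulli_le m u01.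
have ym0 : 0 <= euler i ^+ m by rewrite exprn_ge0.
have ym1 : euler i ^+ m <= 1 by rewrite exprn_ile1.
have ysm : euler i.+1 ^+ m = euler i ^+ m * (1 - u) ^+ m by rewrite eulerS exprMn.
have m0 : 0 <= m%:R :> R by rewrite ler0n.
have bern :
  `|euler i.+1 ^+ m - (euler i ^+ m - h * m%:R * euler i ^+ (m + r).-1)| <= m%:R ^+ 2 * h ^+ 2.
  have -> : euler i.+1 ^+ m - (euler i ^+ m - h * m%:R * euler i ^+ (m + r).-1) =
     euler i ^+ m * ((1 - u) ^+ m - (1 - m%:R * u)).
    by rewrite ysm mr exprD /u; ring.
  rewrite ger0_norm; last by apply: mulr_ge0 => //; lra.
  have le1 : (1 - u) ^+ m - (1 - m%:R * u) <= m%:R ^+ 2 * u ^+ 2 by lra.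
  apply: le_trans (ler_wpM2l ym0 le1) _.
  apply: le_trans (_ : m%:R ^+ 2 * u ^+ 2 <= _).
    by rewrite ler_piMl // mulr_ge0 // sqr_ge0.
  by apply: ler_wpM2l; rewrite ?sqr_ge0 // lerXn2r // nnegrE.
have avg' : `|h / D%:R * Sg - h * m%:R * euler i ^+ (m + r).-1| <=
    h * m%:R * (eps * lam ^+ (m + r).-1) + h / D%:R * m%:R ^+ 2.
  have -> : h / D%:R * Sg - h * m%:R * euler i ^+ (m + r).-1 =
     h / D%:R * (Sg - m%:R * D%:R * euler i ^+ (m + r).-1) by field; rewrite lt0r_neq0.
  rewrite normrM ger0_norm; last by rewrite divr_ge0 // ltW.
  apply: le_trans (ler_wpM2l _ avg) _; first by rewrite divr_ge0 // ltW.
  by rewrite le_eqVlt; apply/orP; left; apply/eqP; field; rewrite lt0r_neq0.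
have cA := close A AW; rewrite -/m in cA.
have lm'0 : 0 <= lam ^+ m' by rewrite exprn_ge0 //; lra.
have lamr : lam ^+ (m + r).-1 <= lam ^+ m' * 4 ^+ r.
  rewrite Em addSn /= exprD; apply: ler_wpM2l => //.
  by apply: lerXn2r; rewrite ?nnegrE; lra.
have mlam : m%:R <= lam ^+ m'.
  apply: le_trans (_ : 2 ^+ m' <= _); last by apply: lerXn2r; rewrite ?nnegrE; lra.
  by rewrite -natrX ler_nat Em ltn_expl.
have cH0 : 0 <= (4 ^+ r + 1) * H by rewrite mulr_ge0 // addr_ge0 // exprn_ge0.
have l0 : 0 <= lam by lra.
have grow := expr_add_ge m' l0 cH0; rewrite -Em in grow.
have hm0 : 0 <= h * m%:R by rewrite mulr_ge0.
have final1 : h * m%:R * (eps * lam ^+ (m + r).-1) <= h * m%:R * (eps * (lam ^+ m' * 4 ^+ r)).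
  by apply: ler_wpM2l => //; apply: ler_wpM2l.
have final2 : h / D%:R * m%:R ^+ 2 + m%:R ^+ 2 * h ^+ 2 <= h * m%:R * (eps * lam ^+ m').
  have -> : h / D%:R * m%:R ^+ 2 + m%:R ^+ 2 * h ^+ 2 = h * m%:R * ((D%:R^-1 + h) * m%:R) by ring.
  apply: ler_wpM2l => //; apply: ler_pM => //; lra.
have final3 : h * m%:R * (eps * (lam ^+ m' * 4 ^+ r)) + h * m%:R * (eps * lam ^+ m') <=
    eps * (m%:R * ((4 ^+ r + 1) * H) * lam ^+ m').
  have -> : h * m%:R * (eps * (lam ^+ m' * 4 ^+ r)) + h * m%:R * (eps * lam ^+ m') =
    h * (m%:R * eps * lam ^+ m' * (4 ^+ r + 1)) by ring.
  have -> : eps * (m%:R * ((4 ^+ r + 1) * H) * lam ^+ m') =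
    H * (m%:R * eps * lam ^+ m' * (4 ^+ r + 1)) by ring.
  apply: ler_wpM2r => //; by rewrite !mulr_ge0.
apply: le_trans (ler_wpM2l e0 grow); rewrite mulrDr.
have -> : survival i A - h / D%:R * Sg - euler i.+1 ^+ m =
  (survival i A - euler i ^+ m) - (h / D%:R * Sg - h * m%:R * euler i ^+ (m + r).-1)
  - (euler i.+1 ^+ m - (euler i ^+ m - h * m%:R * euler i ^+ (m + r).-1)) by ring.
apply: le_trans (ler_normB _ _) _; apply: le_trans (lerD (ler_normB _ _) (lexx _)) _.
lra.
Qed.


Lemma survival_window i0 (eps : R) (L : nat) :
  D%:R^-1 + H <= eps -> 0 <= H -> (4 ^+ r + 1) * H * L%:R <= 2 ->
  (forall A : {set S}, A \subset W ->
    `|survival i0 A - euler i0 ^+ #|A| | <= eps * 2 ^+ #|A|) ->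
  forall l, (l <= L)%N -> (i0 + l <= I)%N -> forall A : {set S}, A \subset W ->
    `|survival (i0 + l) A - euler (i0 + l) ^+ #|A| | <= eps * 4 ^+ #|A|.
Proof.
move=> eps_ge H0 HL start.
have c0 : 0 <= (4 ^+ r + 1) * H by rewrite mulr_ge0 // addr_ge0 // exprn_ge0.
have e0 : 0 <= eps by have : 0 <= D%:R^-1 :> R; [rewrite invr_ge0 | lra].
have lam4 l : (l <= L)%N -> 2 <= 2 + (4 ^+ r + 1) * H * l%:R <= 4.
  move=> lL; have : (4 ^+ r + 1) * H * l%:R <= (4 ^+ r + 1) * H * L%:R.
    by apply: ler_wpM2l => //; rewrite ler_nat.
  have : 0 <= (4 ^+ r + 1) * H * l%:R by rewrite mulr_ge0.
  by move=> ? ?; apply/andP; split; lra.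
have main l : (l <= L)%N -> (i0 + l <= I)%N -> forall A : {set S}, A \subset W ->
    `|survival (i0 + l) A - euler (i0 + l) ^+ #|A| | <=
      eps * (2 + (4 ^+ r + 1) * H * l%:R) ^+ #|A|.
  elim: l => [|l IHl] lL iI A AW; first by rewrite addn0 mulr0 addr0; exact: start.
  rewrite addnS in iI *; rewrite -[l.+1%:R]natr1 mulrDr mulr1 addrA.
  apply: survival_step => //; first by rewrite lam4 // ltnW.
  by move=> B BW; apply: IHl => //; exact: ltnW.
move=> l lL iI A AW; apply: le_trans (main l lL iI A AW) _.
have /andP[l2 l4] := lam4 l lL.
by apply: ler_wpM2l => //; apply: lerXn2r; rewrite ?nnegrE; lra.
Qed.

(** Induction on the number k of windows of L steps.  The bound eps 4^a at the end
    of a window and the trivial bound 1 combine to sqrt(eps) 2^a, which is the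
    hypothesis needed to enter the next window. *)
Lemma survival_close (L k : nat) :
  0 <= H -> D%:R^-1 + H <= 1 -> (4 ^+ r + 1) * H * L%:R <= 2 ->
  forall i, (i <= k * L)%N -> (i <= I)%N -> forall A : {set S}, A \subset W ->
    `|survival i A - euler i ^+ #|A| | <=
      root_iter k (D%:R^-1 + H) * 4 ^+ #|A|.
Proof.
move=> H0 eps1 HL.
have Dv0 : 0 <= D%:R^-1 :> R by rewrite invr_ge0.
have eps01 : 0 <= D%:R^-1 + H <= 1 by apply/andP; split; lra.
elim: k => [|k IHk] i ik iI A AW.
  move: ik; rewrite mul0n leqn0 => /eqP->.
  by rewrite survival_start expr1n subrr normr0 mulr_ge0 ?exprn_ge0 // /root_iter /=; lra.
have /andP[z0 z1] := root_iter_bounds k eps01.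
have /andP[sz0 sz1] := root_iter_bounds k.+1 eps01.
set z := root_iter k _ in z0 z1 IHk.
have zE : root_iter k.+1 (D%:R^-1 + H) = Num.sqrt z by [].
have zs : z <= Num.sqrt z.
  have zz : 0 <= z by lra.
  rewrite -[leLHS](sqr_sqrtr zz) expr2; apply: ler_piMl; first exact: sqrtr_ge0.
  by rewrite -zE; lra.
case: (leqP i (k * L)) => [ikL|kLi].
  apply: le_trans (IHk i ikL iI A AW) _; rewrite zE.
  by apply: ler_wpM2r => //; rewrite exprn_ge0.
have iE : i = (k * L + (i - k * L))%N by rewrite subnKC // ltnW.
rewrite iE; apply: survival_window HL _ _ _ _ _ _ => //.
- move=> B BW; have kLI : (k * L <= I)%N by rewrite (leq_trans (ltnW kLi)).
  have close := IHk _ (leqnn _) kLI B BW.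
  have le1 : `|survival (k * L) B - euler (k * L) ^+ #|B| | <= 1.
    have /andP[y0 y1] := euler01 kLI.
    have p0 := exprn_ge0 #|B| y0; have p1 : euler (k * L) ^+ #|B| <= 1 by rewrite exprn_ile1.
    have kU := leq_trans kLI I_le.
    have f0 := survival_ge0 bd R B kU; have f1 := survival_le1 bd R B kU.
    by rewrite ler_norml; lra.
  rewrite zE; have s0 := sqrtr_ge0 z.
  rewrite -(@ler_pXn2r _ 2) ?nnegrE ?mulr_ge0 ?exprn_ge0 //.
  rewrite exprMn sqr_sqrtr; last by lra.
  have -> : (2 ^+ #|B|) ^+ 2 = 4 ^+ #|B| :> R by rewrite exprAC -natrX.
  by rewrite expr2 -[leRHS]mul1r; apply: ler_pM.
- by rewrite leq_subLR addnC -mulSn.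
by rewrite -iE.
Qed.

(** This is y <= (1 + q t)^(-1/q) for the time t = i D / C and q = r - 1.  The
    scheme stays below the exact solution since
    (1 - u)^q (1 + q u) <= (1 - u^2)^q <= 1. *)
Lemma euler_decay i : (i <= I)%N ->
  euler i ^+ r.-1 * (1 + r.-1%:R * (i%:R * (D%:R / #|U|%:R))) <= 1.
Proof.
elim: i => [|i IHi] iI; first by rewrite mul0r mulr0 addr0 expr1n mulr1.
have IH := IHi (ltnW iI); have /andP[y0 y1] := euler01 (ltnW iI).
have iU := leq_trans iI I_le.
have U0 : 0 < #|U|%:R :> R by rewrite ltr0n (leq_ltn_trans _ iU).
have h0 := rate_ge0 iI; have hH := rateH iI.
rewrite eulerS exprMn.
set h := D%:R / (#|U|%:R - i%:R) in h0 hH *; set h' := D%:R / #|U|%:R in IH *.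
have hh : h' <= h.
  rewrite /h /h' ler_wpM2l // lef_pV2 ?posrE //; last by rewrite subr_gt0 ltr_nat.
  by rewrite gerBl.
set q := r.-1 in IH *; set v := euler i ^+ q in IH *; set u := h * v.
have v0 : 0 <= v by rewrite exprn_ge0.
have v1 : v <= 1 by rewrite exprn_ile1.
have u0 : 0 <= u by rewrite mulr_ge0.
have u1 : u <= 1.
  by apply: mulr_ile1 => //; apply: le_trans hH H_le1.
have q0 : 0 <= q%:R :> R by [].
have le1 : v * (1 + q%:R * (i.+1%:R * h')) <= 1 + q%:R * u.
  have -> : v * (1 + q%:R * (i.+1%:R * h')) = v * (1 + q%:R * (i%:R * h')) + q%:R * (h' * v).
    by rewrite -natr1; ring.
  by apply: lerD => //; apply: ler_wpM2l => //; apply: ler_wpM2r.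
have le2 : 1 + q%:R * u <= (1 + u) ^+ q.
  case: (q) => [|q']; first by rewrite mul0r addr0 expr0.
  by have := expr_add_ge q' ler01 u0; rewrite !expr1n !mulr1.
have u0' : 0 <= (1 - u) ^+ q by rewrite exprn_ge0 // subr_ge0.
rewrite [v * (1 - u) ^+ q]mulrC -mulrA.
apply: le_trans (ler_wpM2l u0' (le_trans le1 le2)) _.
rewrite -exprMn exprn_ile1 //; first by rewrite mulr_ge0 //; lra.
by have := sqr_ge0 u; lra.
Qed.

Definition deficit (y : R) (w : seq E) : R :=
  (#|W|%:R - #|covered bd (greedy bd w)|%:R) / #|W|%:R - y.

Lemma uncovered_alive w : all (mem U) w ->
  #|W|%:R - #|covered bd (greedy bd w)|%:R = \sum_(s in W) (alive bd [set s] w)%:R :> R.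
Proof.
move=> wU; have sub := covered_greedy_sub bd_sub wU.
rewrite -natrB ?subset_leq_card // -natr_sum; congr _%:R.
rewrite -[in LHS](setIidPr sub) -cardsD -sum1_card big_mkcond /= [RHS]big_mkcond /=.
apply: eq_bigr => s _; rewrite inE /alive disjoints1.
by case: (s \in W); case: (s \in _).
Qed.

(** Expanding the square of a sum of indicators leaves the survival probabilities
    of sets with at most two points, which are close to y and y^2; the diagonal
    accounts for the term 1/N. *)
Lemma deficit_second_moment (eps : R) : (0 < #|W|)%N -> 0 <= eps ->
  (forall A : {set S}, A \subset W ->
    `|survival I A - euler I ^+ #|A| | <= eps * 4 ^+ #|A|) ->
  expect U I (fun w => deficit (euler I) w ^+ 2) <= 24 * eps + #|W|%:R^-1.
Proof.
move=> W0 e0 close; set y := euler I; set N : R := #|W|%:R.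
have N0 : 0 < N by rewrite ltr0n.
have /andP[y0 y1] := euler01 (leqnn I).
have single s : s \in W -> y - 4 * eps <= survival I [set s].
  by move=> sW; have := close [set s]; rewrite sub1set cards1 !expr1 => /(_ sW); rewrite ler_norml -/y => ?; lra.
have pair s t : s \in W -> t \in W ->
    survival I ([set s] :|: [set t]) <= y ^+ 2 + 16 * eps + (s == t)%:R.
  move=> sW tW; case: eqVneq => [_|nst] /=.
    have := survival_le1 bd R ([set s] :|: [set t]) I_le; have := sqr_ge0 y.
    by move=> ? ?; lra.
  have := close ([set s] :|: [set t]); rewrite subUset !sub1set sW tW => /(_ isT).
  by rewrite cardsU1 !inE nst cards1 -/y ler_norml => ?; lra.
have mean : N * (y - 4 * eps) <= \sum_(s in W) survival I [set s].
  by rewrite /N mulr_natl -sumr_const; apply: ler_sum => s sW; exact: single.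
have square :
  \sum_(s in W) \sum_(t in W) survival I ([set s] :|: [set t]) <=
  N * (N * (y ^+ 2 + 16 * eps) + 1).
  rewrite /N mulr_natl -sumr_const; apply: ler_sum => s sW.
  apply: le_trans (ler_sum _ (fun t tW => pair s t sW tW)) _.
  rewrite big_split /= sumr_const -[_ *+ #|W|]mulr_natl lerD2l.
  by rewrite (bigD1 s) //= eqxx big1 ?addr0 // => t /andP[_]; rewrite eq_sym => /negbTE->.
have -> : expect U I (fun w => deficit y w ^+ 2) =
   N^-1 ^+ 2 * (\sum_(s in W) \sum_(t in W) survival I ([set s] :|: [set t]))
   + (- 2 * y / N) * (\sum_(s in W) survival I [set s]) + y ^+ 2.
  transitivity (expect U I (fun w =>
      (N^-1 ^+ 2 * (\sum_(s in W) \sum_(t in W) (alive bd ([set s] :|: [set t]) w)%:R)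
      + (- 2 * y / N) * (\sum_(s in W) (alive bd [set s] w)%:R)) + y ^+ 2)); last first.
    rewrite !expectD !expectZ expect_cst // !expect_sum.
    by under eq_bigr do rewrite expect_sum.
  apply: eq_expect => w /and3P[_ wU _].
  rewrite /deficit uncovered_alive // -/N.
  have -> : \sum_(s in W) \sum_(t in W) (alive bd ([set s] :|: [set t]) w)%:R =
            (\sum_(s in W) (alive bd [set s] w)%:R) ^+ 2 :> R.
    rewrite expr2 mulr_suml; apply: eq_bigr => s _; rewrite mulr_sumr; apply: eq_bigr => t _.
    by rewrite aliveU -mulnb natrM.
  by field; rewrite lt0r_neq0.
apply: le_trans (_ : N^-1 ^+ 2 * (N * (N * (y ^+ 2 + 16 * eps) + 1))
  - 2 * y / N * (N * (y - 4 * eps)) + y ^+ 2 <= _).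
  rewrite lerD2r; apply: lerD; first by apply: ler_wpM2l => //; rewrite sqr_ge0.
  rewrite !mulNr lerN2; apply: ler_wpM2l => //.
  by rewrite divr_ge0 ?mulr_ge0 // ltW.
have -> : N^-1 ^+ 2 * (N * (N * (y ^+ 2 + 16 * eps) + 1))
  - 2 * y / N * (N * (y - 4 * eps)) + y ^+ 2 =
  16 * eps + 8 * (y * eps) + N^-1.
  by field; rewrite lt0r_neq0.
have : y * eps <= eps by rewrite ler_piMl.
by lra.
Qed.

Lemma greedy_matching_large (eps delta : R) : (0 < #|W|)%N -> 0 <= eps -> 0 < delta ->
  (forall A : {set S}, A \subset W ->
    `|survival I A - euler I ^+ #|A| | <= eps * 4 ^+ #|A|) ->
  1 - (24 * eps + #|W|%:R^-1) / delta ^+ 2 <=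
  expect U I (fun w => (#|W|%:R * (1 - euler I - delta) < r%:R * #|greedy bd w|%:R :> R)%:R).
Proof.
move=> W0 e0 d0 close; have moment := deficit_second_moment W0 e0 close.
have d20 : 0 < delta ^+ 2 by rewrite exprn_gt0.
have N0 : 0 < #|W|%:R :> R by rewrite ltr0n.
apply: le_trans (_ : 1 - expect U I (fun w => deficit (euler I) w ^+ 2) / delta ^+ 2 <= _).
  by rewrite lerD2l lerN2 ler_pM2r // invr_gt0.
have -> : 1 - expect U I (fun w => deficit (euler I) w ^+ 2) / delta ^+ 2 =
    expect U I (fun w => 1 + (- (delta ^+ 2)^-1) * deficit (euler I) w ^+ 2).
  by rewrite expectD expectZ expect_cst // mulNr [_ / _]mulrC.
apply: expect_le => // w /and3P[_ wU _]; rewrite mulNr.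
case: ltP => [_|small] /=; first by rewrite gerBl mulr_ge0 ?sqr_ge0 // invr_ge0 ltW.
have dd : delta <= deficit (euler I) w.
  rewrite /deficit (card_covered r_gt0 card_bd) // natrM lerBrDr ler_pdivlMr //.
  by rewrite lerBrDl -lerBrDr; lra.
rewrite subr_le0 mulrC ler_pdivlMr // mul1r; apply: lerXn2r; rewrite ?nnegrE //.
  exact: ltW.
exact: le_trans (ltW d0) dd.
Qed.

End Stability.

(** * From a random order to a binomial random subset *)

Section Transfer.
Variables (R : realFieldType) (E : finType) (U : {set E}) (p : R).

(** Given its size, a binomial random subset is uniform, hence distributed as an
    initial segment of a random order. *)
Lemma bernoulli_subset_mean (phi : {set E} -> R) :
  \sum_(G : {set E} | G \subset U) p ^+ #|G| * (1 - p) ^+ (#|U| - #|G|) * phi G =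
  binomial_mean p #|U| (fun m => expect U m (fun w => phi [set e in w])).
Proof.
rewrite (partition_big (fun G : {set E} => inord #|G| : 'I_#|U|.+1) predT) //=.
apply: eq_bigr => m _.
rewrite mulrAC (expect_set phi (_ : m <= #|U|)%N) -1?ltnS // mulrC mulr_sumr.
apply: eq_big => [G|G /andP[GU]].
  case: (boolP (G \subset U)) => //= GU.
  by rewrite -val_eqE /= inordK // ltnS subset_leq_card.
by move=> /eqP <-; rewrite inordK // ltnS subset_leq_card.
Qed.

(** A binomial random subset has at least I elements up to the Chebyshev error,
    and more draws only help the greedy matching.  The statement is about an
    arbitrary event B implied by a large greedy matching, because the order of
    the edges is not a function of the random subset. *)
Lemma random_subset_lower (S : finType) (bd : E -> {set S}) (B : pred {set E}) (P : pred nat)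
    (I : nat) (t : R) :
  0 <= p <= 1 -> 0 < t -> (I <= #|U|)%N -> I%:R <= #|U|%:R * p - t ->
  (forall a b, (a <= b)%N -> P a -> P b) ->
  (forall w, all (mem U) w -> P #|greedy bd w| -> B [set e in w]) ->
  expect U I (fun w => (P #|greedy bd w|)%:R) - #|U|%:R * p / t ^+ 2 <=
  \sum_(G : {set E} | (G \subset U) && B G) p ^+ #|G| * (1 - p) ^+ (#|U| - #|G|).
Proof.
move=> p01 t0 IU It monoP PB.
have -> : \sum_(G : {set E} | (G \subset U) && B G) p ^+ #|G| * (1 - p) ^+ (#|U| - #|G|)
  = \sum_(G : {set E} | G \subset U) p ^+ #|G| * (1 - p) ^+ (#|U| - #|G|) * (B G)%:R.
  by rewrite big_mkcondr; apply: eq_bigr => G _; case: (B G); rewrite ?mulr1 ?mulr0.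
rewrite bernoulli_subset_mean.
set b := expect U I _.
have b01 : 0 <= b <= 1.
  rewrite expect_ge0 //= -(expect_cst 1 IU); apply: expect_le => // w _.
  by rewrite lern1 leq_b1.
apply: le_trans (binomial_lower_tail p01 t0 b01 It) _.
apply: binomial_mean_le => // m mU; case: leqP => [Im|_]; last first.
  by rewrite mulr0n expect_ge0.
rewrite mulr1n; apply: le_trans (expect_mono (m' := m) _ _) _.
- by rewrite Im.
- move=> e w; case Pw: (P _) => //.
  by rewrite (monoP _ _ (greedy_cons_card bd e w) Pw).
apply: expect_le => // w /and3P[_ wU _]; case Pw: (P _) => //.
by rewrite PB.
Qed.

End Transfer.

(** * The hypergraph of (r-1)-sets *)

Section Shadows.
Variables (n r : nat).
Hypothesis r_gt1 : (1 < r)%N.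
Local Notation V := 'I_n.

Definition rsets k : {set {set V}} := [set e : {set V} | #|e| == k].
Definition shadow (e : {set V}) : {set {set V}} :=
  [set s : {set V} | (s \subset e) && (#|s| == r.-1)].

Lemma card_rsets k : #|rsets k| = 'C(n, k).
Proof. by rewrite card_draws card_ord. Qed.

Lemma shadow_sub e : e \in rsets r -> shadow e \subset rsets r.-1.
Proof. by move=> _; apply/subsetP=> s; rewrite !inE => /andP[]. Qed.

Lemma card_shadow e : e \in rsets r -> #|shadow e| = r.
Proof.
rewrite inE /shadow => /eqP er; rewrite cards_draws er.
by rewrite -{1}(prednK (ltnW r_gt1)) binSn prednK // ltnW.
Qed.

Lemma shadow_degree s : s \in rsets r.-1 ->
  #|[set e in rsets r | s \in shadow e]| = (n - r.-1)%N.
Proof.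
rewrite inE => sr; have -> : [set e in rsets r | s \in shadow e] = [set x |: s | x in ~: s].
  apply/setP=> e; rewrite !inE sr andbT; apply/andP/imsetP.
    case=> /eqP er se; have : (0 < #|e :\: s|)%N.
      by rewrite cardsDS // er (eqP sr) subn_gt0 prednK // ltnW.
    case/card_gt0P=> x; rewrite inE => /andP[xs xe]; exists x; first by rewrite inE.
    apply/eqP; rewrite eq_sym eqEcard subUset sub1set xe se /= er cardsU1 xs (eqP sr).
    by rewrite add1n prednK // ltnW.
  case=> x; rewrite inE => xs ->; split; last exact: subsetUr.
  by rewrite cardsU1 xs (eqP sr) add1n prednK // ltnW.
rewrite card_in_imset => [|x y]; first by rewrite cardsCs setCK card_ord (eqP sr).
rewrite !inE => xs ys /setP/(_ x); rewrite !inE eqxx (negbTE xs) !orbF.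
by move=> /esym/eqP.
Qed.

(** Two distinct (r-1)-subsets of an r-set have that r-set as their union. *)
Lemma shadow_codegree s t : s != t ->
  (#|[set e in rsets r | (s \in shadow e) && (t \in shadow e)]| <= 1)%N.
Proof.
move=> nst; rewrite leqNgt; apply/negP=> /card_gt1P[e [f [+ + nef]]].
have uniq_e g : g \in [set e in rsets r | (s \in shadow e) && (t \in shadow e)] -> g = s :|: t.
  rewrite !inE => /and3P[/eqP gr /andP[sg /eqP sr] /andP[tg /eqP tr]].
  apply/eqP; rewrite eq_sym eqEcard subUset sg tg /= gr leqNgt; apply/negP.
  rewrite -{1}(prednK (ltnW r_gt1)) ltnS => stle.
  have sE : s :|: t = s by apply/esym/eqP; rewrite eqEcard subsetUl sr.
  have tE : s :|: t = t by apply/esym/eqP; rewrite eqEcard subsetUr tr.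
  by rewrite -sE {1}tE eqxx in nst.
by move=> /uniq_e ee /uniq_e fe; rewrite ee fe eqxx in nef.
Qed.

(** Two r-sets with at least r - 1 common vertices share a point of their
    shadows. *)
Lemma greedy_nu w : all (mem (rsets r)) w ->
  (#|greedy shadow w| <= nu r.-1 [set e in w])%N.
Proof.
move=> wU.
apply: (@leq_bigmax_cond _ (is_kmatching r.-1 [set e in w])
  (fun M : {set {set V}} => #|M|)).
rewrite /is_kmatching greedy_sub /=; apply/forall_inP=> e eM; apply/forall_inP=> f fM.
apply/implyP=> nef; rewrite ltnNge; apply/negP=> le.
have := greedy_disjoint eM fM nef; rewrite -setI_eq0 => /eqP dis.
have : (0 < #|[set B : {set V} | (B \subset e :&: f) && (#|B| == r.-1)]|)%N.
  by rewrite cards_draws bin_gt0.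
case/card_gt0P=> B; rewrite inE subsetI -andbA => /and3P[Be Bf Br].
have : B \in shadow e :&: shadow f by rewrite !inE Be Bf Br.
by rewrite dis inE.
Qed.

Lemma H_probE (R : realType) (p : R) (B : pred {set {set V}}) :
  H_prob r p B = \sum_(G : {set {set V}} | (G \subset rsets r) && B G)
                   p ^+ #|G| * (1 - p) ^+ (#|rsets r| - #|G|).
Proof.
have rgE G : is_rgraph r G = (G \subset rsets r).
  apply/forall_inP/subsetP => [rG e eG|GU e eG]; first by rewrite inE rG.
  by have := GU e eG; rewrite inE.
rewrite /H_prob; apply: eq_big => [G|G]; first by rewrite rgE.
rewrite rgE => /andP[GU _]; rewrite /H_mass (bigID (mem G)) /=; congr (_ * _).
  rewrite (eq_bigr (fun=> p)); last by move=> e /andP[_ ->].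
  rewrite prodr_const; congr (_ ^+ _); apply: eq_card => e.
  rewrite [LHS]unfold_in /=; apply/andP/idP => [[]//|eG]; split=> //.
  by have := subsetP GU e eG; rewrite inE.
rewrite (eq_bigr (fun=> 1 - p)); last by move=> e /andP[_ /negbTE->].
rewrite prodr_const -cardsDS //; congr (_ ^+ _); apply: eq_card => e.
by rewrite [LHS]unfold_in !inE /= andbC.
Qed.

End Shadows.

(** * Elementary estimates *)

Lemma bin_ge_sub m q : (0 < q)%N -> (q <= m)%N -> (m - q < 'C(m, q))%N.
Proof.
elim: m q => [|m IHm] [|q] // _ qm; rewrite binS subSS.
case: (ltnP q m) => [qm'|mq]; last first.
  have -> : q = m by apply/eqP; rewrite eqn_leq mq andbT -ltnS.
  by rewrite subnn binn addn1.
have := IHm q.+1 isT qm'.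
have : (0 < 'C(m, q))%N by rewrite bin_gt0 ltnW.
lia.
Qed.

(** With x = (q d + 1)^(-1/q) one has y <= x (1 + q (d - tau)): the q-th power of
    the right-hand side is at least (1 + q (d - tau)) / (1 + q d), which
    is at least 1 / (1 + q tau). *)
Lemma alpha_ge_survivors (R : realType) (q : nat) (d tau y : R) : (0 < q)%N -> 0 <= d ->
  0 <= tau <= d -> 0 <= y -> y ^+ q * (1 + q%:R * tau) <= 1 ->
  alpha q.+1 d - q%:R * (d - tau) <= 1 - y.
Proof.
move=> q0 d0 /andP[t0 td] y0 yq; rewrite /alpha /= div1r.
have qR : 0 < q%:R :> R by rewrite ltr0n.
set b := (q%:R * d + 1)^-1; set x := powR b (1 / q%:R).
have b1 : 0 < q%:R * d + 1 by rewrite ltr_wpDl // mulr_ge0.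
have b0 : 0 <= b by rewrite invr_ge0 ltW.
have x0 : 0 <= x by exact: powR_ge0.
have xq : x ^+ q = b.
  by rewrite -powR_mulrn // /x -powRrM mul1r mulVf ?lt0r_neq0 // powRr1.
have x1 : x <= 1.
  rewrite -(@ler_pXn2r _ q) ?nnegrE // expr1n xq invf_le1 // lerDr mulr_ge0 //.
have s0 : 0 <= q%:R * (d - tau) by rewrite mulr_ge0 // subr_ge0.
suff : y <= x * (1 + q%:R * (d - tau)).
  have : x * (q%:R * (d - tau)) <= q%:R * (d - tau) by rewrite ler_piMl.
  by lra.
rewrite -(@ler_pXn2r _ q) ?nnegrE //; last by rewrite mulr_ge0 //; lra.
rewrite exprMn xq.
have grow : 1 + q%:R * (d - tau) <= (1 + q%:R * (d - tau)) ^+ q.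
  by rewrite -{1}[1 + _]expr1; apply: ler_weXn2l => //; lra.
have t1 : 0 < 1 + q%:R * tau by rewrite ltr_pwDl // mulr_ge0.
apply: le_trans (ler_wpM2l b0 grow).
rewrite mulrC -[leRHS]/(_ / _) ler_pdivlMr // -(ler_pM2r t1) mulrAC.
apply: le_trans (ler_wpM2r (ltW b1) yq) _.
have : 0 <= (q%:R * tau) * (q%:R * (d - tau)) by rewrite !mulr_ge0 // subr_ge0.
by lra.
Qed.

Lemma alpha_gt0 (R : realType) (r : nat) (d : R) : (1 < r)%N -> 0 < d -> 0 < alpha r d.
Proof.
move=> r1 d0; rewrite /alpha subr_gt0.
have q0 : 0 < r.-1%:R :> R by rewrite ltr0n -ltnS prednK // ltnW.
have qd : 0 < r.-1%:R * d by rewrite mulr_gt0.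
have one_powR : powR 1 (1 / r.-1%:R) = 1 :> R by rewrite powR1.
rewrite -[ltRHS]one_powR.
apply: gt0_ltr_powR; rewrite ?nnegrE ?divr_gt0 //.
  by rewrite divr_ge0 // addr_ge0 // ltW.
by rewrite ltr_pdivrMr ?mul1r; lra.
Qed.

Lemma alpha_le (R : realType) (r : nat) (c d : R) : 0 <= c <= d -> alpha r c <= alpha r d.
Proof.
move=> /andP[c0 cd]; rewrite /alpha lerD2l lerN2.
have cp : 0 < r.-1%:R * c + 1 by rewrite ltr_wpDl // mulr_ge0.
have dp : r.-1%:R * c + 1 <= r.-1%:R * d + 1 by rewrite lerD2r ler_wpM2l.
apply: ge0_ler_powR; rewrite ?nnegrE ?divr_ge0 //; [lra | lra |].
by rewrite !div1r lef_pV2 ?posrE //; lra.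
Qed.

Lemma H_prob_le1 (R : realType) (n r : nat) (p : R) (B : pred {set {set 'I_n}}) :
  0 <= p <= 1 -> H_prob r p B <= 1.
Proof.
move=> p01; rewrite H_probE; have /andP[p0 p1] := p01.
have q0 : 0 <= 1 - p by rewrite subr_ge0.
apply: le_trans (_ : \sum_(G : {set {set 'I_n}} | G \subset rsets n r)
    p ^+ #|G| * (1 - p) ^+ (#|rsets n r| - #|G|) * 1 <= _).
  rewrite big_mkcondr; apply: ler_sum => G _; rewrite mulr1.
  by case: (B G); rewrite ?mulr_ge0 ?exprn_ge0.
rewrite (bernoulli_subset_mean (rsets n r) p (fun=> 1)) -[leRHS](binomial_mean1 p #|rsets n r|).
by apply: binomial_mean_le => // m mU; rewrite expect_cst.
Qed.

Lemma H_prob_mono (R : realType) (n r : nat) (p : R) (B B' : pred {set {set 'I_n}}) :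
  0 <= p <= 1 -> (forall G, B G -> B' G) -> H_prob r p B <= H_prob r p B'.
Proof.
move=> /andP[p0 p1] BB'; have q0 : 0 <= 1 - p by rewrite subr_ge0.
rewrite !H_probE !big_mkcondr; apply: ler_sum => G _.
case BG: (B G); first by rewrite BB'.
by case: (B' G); rewrite ?mulr_ge0 ?exprn_ge0.
Qed.

(** * Explicit bounds at a fixed number of vertices *)

Section FixedOrder.
Variables (R : realType) (n r : nat) (p : R).
Hypotheses (r_gt1 : (1 < r)%N) (r_le_n : (r <= n)%N) (p01 : 0 <= p <= 1).
Local Notation N := ('C(n, r.-1)%:R : R).
Local Notation C := ('C(n, r)%:R : R).
Local Notation D := ((n - r.-1)%:R : R).

(** The greedy bound for the hypergraph of (r-1)-sets.  For p <= 1/2 at most half of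
    the edges are drawn, so each step size is at most H = 2 D / C.  The
    hypothesis on a quantifies over y because the Euler scheme is known only
    through the bound of [euler_decay]. *)
Lemma matching_prob_lower (L k I : nat) (delta t a : R) :
  p <= 2^-1 -> D^-1 + 2 * D / C <= 1 -> (4 ^+ r + 1) * (2 * D / C) * L%:R <= 2 ->
  (I <= k * L)%N -> 0 < delta -> 0 < t -> I%:R <= C * p - t ->
  (forall y : R, 0 <= y -> y ^+ r.-1 * (1 + r.-1%:R * (I%:R * (D / C))) <= 1 ->
     r%:R * a <= N * (1 - y - delta)) ->
  1 - (24 * root_iter k (D^-1 + 2 * D / C) + N^-1) / delta ^+ 2 - C * p / t ^+ 2 <=
  H_prob r p (fun G : {set {set 'I_n}} => a < (nu r.-1 G)%:R).
Proof.
move=> p_half eps1 HL IkL d0 t0 It aH; rewrite H_probE.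
have r0 := ltnW r_gt1.
have D0 : (0 < n - r.-1)%N by rewrite subn_gt0 prednK.
have DR : 0 < D by rewrite ltr0n.
have C0 : 0 < C by rewrite ltr0n bin_gt0.
have N0 : (0 < #|rsets n r.-1|)%N by rewrite card_rsets bin_gt0 (leq_trans (leq_pred _)).
have Ip : I%:R <= C * p by lra.
have Ihalf : I%:R <= C * 2^-1 by apply: le_trans Ip _; rewrite ler_pM2l.
have IC : (I <= #|rsets n r|)%N by rewrite card_rsets -(ler_nat R); lra.
set H := 2 * D / C in eps1 HL *.
have H0 : 0 <= H by rewrite divr_ge0 ?mulr_ge0 // ltW.
have H1 : H <= 1 by have : 0 <= D^-1 by [rewrite invr_ge0]; lra.
have rateH i : (i < I)%N -> D / (#|rsets n r|%:R - i%:R) <= H.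
  move=> iI; have iR : i%:R <= I%:R :> R by rewrite ler_nat ltnW.
  rewrite card_rsets /H ler_pdivrMr; last by lra.
  have -> : 2 * D / C * (C - i%:R) = D * (2 * (C - i%:R) / C) by ring.
  by rewrite ler_peMr ?(ltW DR) // ler_pdivlMr // mul1r; lra.
have close := survival_close r0 (@shadow_sub n r) (@card_shadow n r r_gt1)
  (@shadow_degree n r r_gt1) (@shadow_codegree n r r_gt1) D0 IC rateH H1 H0 eps1 HL IkL (leqnn I).
have eps01 : 0 <= D^-1 + H <= 1 by rewrite eps1 addr_ge0 // invr_ge0.
have e0 : 0 <= root_iter k (D^-1 + H).
  by case/andP: (root_iter_bounds k eps01) => ? _; case/andP: eps01 => ? _; lra.
have big := greedy_matching_large r0 (@shadow_sub n r) (@card_shadow n r r_gt1)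
  IC rateH H1 N0 e0 d0 close.
have decay := euler_decay r0 IC rateH H1 (leqnn I).
have /andP[y0 y1] := euler01 r0 IC rateH H1 (leqnn I).
have trans := @random_subset_lower R _ (rsets n r) p _ (shadow (n:=n) r)
  (fun G => a < (nu r.-1 G)%:R)
  (fun b => N * (1 - euler (rsets n r) r (n - r.-1) R I - delta) < r%:R * b%:R) I t p01 t0 IC.
rewrite !card_rsets in trans big decay *.
apply: le_trans (lerD big (lexx _)) _; apply: trans => //.
  by move=> b b' bb' /lt_le_trans; apply; rewrite ler_wpM2l // ler_nat.
move=> w wU lt; have le := greedy_nu wU.
have rp : 0 < r%:R :> R by rewrite ltr0n.
rewrite -(ltr_pM2l rp); apply: le_lt_trans (aH _ y0 decay) _.
by apply: lt_le_trans lt _; rewrite ler_pM2l // ler_nat.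
Qed.

(** Here I is about (1 - delta) p C draws, so the elapsed time I D / C falls short
    of d by at most delta d + r / N.  Windows have L steps with
    1 <= (4^r + 1) H L <= 2, and as I H <= 2 d1, the condition on k makes k
    windows enough. *)
Lemma matching_prob_explicit (c0 d1 delta : R) (k : nat) :
  0 < c0 -> c0 <= avg_codegree r n p <= d1 -> 0 < delta < 1 ->
  p <= 2^-1 -> (1 + 2 * r%:R) / D <= 1 -> (4 ^+ r + 1) * (2 * r%:R / D) <= 1 ->
  2 * (4 ^+ r + 1) * d1 <= k%:R ->
  1 - (24 * root_iter k ((1 + 2 * r%:R) / D) + (1 + r%:R / c0) / D) / delta ^+ 2 <=
  H_prob r p (fun G : {set {set 'I_n}} =>
    N / r%:R * (alpha r (avg_codegree r n p)
                - (r.-1%:R * d1 + r.-1%:R * r%:R + 1) * (delta + D^-1))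
    < (nu r.-1 G)%:R).
Proof.
move=> c00 /andP[cd dd1] /andP[del0 del1] p_half eps1 H1 k_ge.
set d := avg_codegree r n p in cd dd1 *.
have r0 := ltnW r_gt1; have rR : 0 < r%:R :> R by rewrite ltr0n.
have q0 : (0 < r.-1)%N by rewrite -ltnS prednK.
have qn : (r.-1 <= n)%N by rewrite (leq_trans (leq_pred _)).
have D0 : (0 < n - r.-1)%N by rewrite subn_gt0 prednK.
have DR : 0 < D by rewrite ltr0n.
have C0 : 0 < C by rewrite ltr0n bin_gt0.
have NR : 0 < N by rewrite ltr0n bin_gt0.
have ND : D <= N.
  by rewrite ler_nat; exact: ltnW (bin_ge_sub q0 qn).
have NDC : N * D = C * r%:R.
  rewrite -!natrM mulnC [in RHS]mulnC; congr _%:R.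
  by have := mul_bin_left n r.-1; rewrite prednK.
have DC : D / C = r%:R / N by apply/eqP; rewrite eqr_div ?lt0r_neq0 // mulrC NDC mulrC.
have dE : d = D * p by rewrite /d /avg_codegree natrB.
have NV : N^-1 <= D^-1 by rewrite lef_pV2.
have NV0 : 0 < N^-1 by rewrite invr_gt0.
have DV0 : 0 < D^-1 by rewrite invr_gt0.
have d0 : 0 < d by exact: lt_le_trans cd.
have p0 : 0 < p by rewrite dE pmulr_rgt0 in d0.
have Cp : C * p = d * N / r%:R.
  by rewrite dE [D * p * N]mulrC mulrA NDC mulrAC mulfK // lt0r_neq0.
have Cp0 : 0 < C * p by rewrite mulr_gt0.
have rNV : r%:R * N^-1 <= r%:R * D^-1 by rewrite ler_pM2l.
set c : R := 4 ^+ r + 1 in H1 k_ge.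
have c_gt0 : 0 < c by rewrite ltr_wpDl // exprn_ge0.
have HE : 2 * D / C = 2 * (r%:R / N) by rewrite -mulrA DC.
have H0 : 0 < 2 * D / C by rewrite !mulr_gt0 // invr_gt0.
have cH1 : c * (2 * D / C) <= 1.
  apply: le_trans H1; rewrite HE -mulrA ler_pM2l // ler_pM2l //.
have cH0 : 0 < c * (2 * D / C) by rewrite mulr_gt0.
pose I := Num.truncn ((1 - delta) * (C * p)).
pose L := Num.truncn (2 / (c * (2 * D / C))).
have /andP[I1 I2] : I%:R <= (1 - delta) * (C * p) < I.+1%:R.
  by apply: truncn_itv; rewrite mulr_ge0 ?ltW //; lra.
have /andP[L1 L2] : L%:R <= 2 / (c * (2 * D / C)) < L.+1%:R.
  by apply: truncn_itv; rewrite divr_ge0 // ltW.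
have HL : c * (2 * D / C) * L%:R <= 2 by rewrite mulrC -ler_pdivlMr.
have HL1 : 1 <= c * (2 * D / C) * L%:R.
  have : 2 < c * (2 * D / C) * (L%:R + 1) by rewrite mulrC natr1 -ltr_pdivrMr.
  by lra.
have Idel : I%:R <= C * p - delta * (C * p) by lra.
have dCp : 0 < delta * (C * p) by rewrite mulr_gt0.
have IkL : (I <= k * L)%N.
  rewrite -(ler_nat R) natrM -(ler_pM2l cH0).
  apply: le_trans (_ : c * (2 * D / C) * (C * p) <= _).
    by rewrite ler_pM2l //; lra.
  have -> : c * (2 * D / C) * (C * p) = 2 * c * d.
    by rewrite dE; field; rewrite lt0r_neq0.
  apply: le_trans (_ : k%:R <= _).
    by apply: le_trans k_ge; rewrite ler_pM2l // mulr_gt0.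
  by rewrite mulrCA ler_peMr.
set K := r.-1%:R * d1 + r.-1%:R * r%:R + 1.
set a := N / r%:R * (alpha r d - K * (delta + D^-1)).
have epsE : D^-1 + 2 * D / C <= (1 + 2 * r%:R) / D.
  by rewrite HE [leRHS]mulrDl mul1r lerD2l -mulrA ler_pM2l.
have eps1' := le_trans epsE eps1.
have main := matching_prob_lower (a := a) p_half eps1' HL IkL del0 dCp Idel.
apply: le_trans (main _); last first.
  move=> y y0 yq; rewrite /a mulrA mulrCA mulfV ?lt0r_neq0 // mulr1 ler_pM2l //.
  set tau := I%:R * (D / C) in yq.
  have tau0 : 0 <= tau by rewrite mulr_ge0 // divr_ge0 // ltW.
  have dCp' : d = (C * p) * (D / C) by rewrite dE; field; rewrite lt0r_neq0.
  have DC0 : 0 < D / C by rewrite divr_gt0.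
  have taud : tau <= d.
    by rewrite dCp' ler_pM2r //; lra.
  have dtau : d - tau <= delta * d + r%:R / D.
    have : d - tau <= (delta * (C * p) + 1) * (D / C).
      by rewrite dCp' /tau -mulrBl ler_pM2r // -natr1 in I2 *; lra.
    rewrite mulrDl mul1r -mulrA -dCp' DC; lra.
  have := @alpha_ge_survivors R r.-1 d tau y q0 (ltW d0) _ y0 yq.
  rewrite tau0 taud prednK // => /(_ isT).
  have : r.-1%:R * (d - tau) <= r.-1%:R * (delta * d1 + r%:R / D).
    apply: ler_wpM2l => //; apply: le_trans dtau _; rewrite lerD2r.
    by rewrite ler_pM2l.
  have q0R : 0 <= r.-1%:R :> R by [].
  have d10 : 0 <= d1 by apply: le_trans dd1; exact: ltW.
  have : 0 <= r.-1%:R * d1 * D^-1 by rewrite !mulr_ge0 // ltW.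
  have : 0 <= r.-1%:R * r%:R * delta by rewrite !mulr_ge0 // ltW.
  by rewrite /K; lra.
have del2 : 0 < delta ^+ 2 by rewrite exprn_gt0.
have -> : C * p / (delta * (C * p)) ^+ 2 = (r%:R / (d * N)) / delta ^+ 2.
  have inv_sqr (x e : R) : 0 < x -> 0 < e -> x / (e * x) ^+ 2 = x^-1 / e ^+ 2.
    by move=> x0 e0; field; rewrite !lt0r_neq0.
  by rewrite inv_sqr // Cp invf_div.
rewrite -addrA -opprD lerD2l lerN2 -mulrDl ler_pM2r ?invr_gt0 //.
have e1 : root_iter k (D^-1 + 2 * D / C) <= root_iter k ((1 + 2 * r%:R) / D) by exact: root_iter_le.
have e2 : r%:R / (d * N) <= r%:R / c0 / D.
  have dN0 : 0 < d * N by apply: mulr_gt0.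
  have cD0 : 0 < c0 * D by apply: mulr_gt0.
  rewrite -mulrA -invfM ler_pM2l // lef_pV2 //.
  by apply: ler_pM => //; exact: ltW.
by rewrite [(1 + r%:R / c0) / D]mulrDl mul1r; lra.
Qed.

End FixedOrder.

(** * Asymptotics *)

Local Open Scope classical_set_scope.
Local Open Scope ring_scope.

Lemma cvg_inv_sub (R : realType) (q : nat) : ((n - q)%:R^-1 : R) @[n --> \oo] --> (0 : R).
Proof.
rewrite (cvg_centern q (fun n => n%:R^-1 : R)) -(cvg_shiftn 1).
under eq_fun do rewrite addn1.
exact: cvg_harmonic.
Qed.

Lemma cvg_root_iter (R : realType) (k : nat) (u : nat -> R) :
  u n @[n --> \oo] --> (0 : R) -> root_iter k (u n) @[n --> \oo] --> (0 : R).
Proof.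
move=> u0; elim: k => [//|k IHk]; rewrite -sqrtr0.
exact: (continuous_cvg _ (@sqrt_continuous R 0) IHk).
Qed.

Theorem theorem1p12 (R : realType) (r : nat) (hr : (3 <= r)%N) (p : nat -> R)
    (hp : forall n : nat, 0 <= p n <= 1)
    (hd : Theta1 (fun n : nat => avg_codegree r n (p n))) :
  exists eps : nat -> R,
    (eps n @[n --> \oo] --> (0 : R)) /\
    (H_prob r (p n) (fun G : {set {set 'I_n}} =>
        (1 + eps n) * (1 / r%:R) * alpha r (avg_codegree r n (p n))
          * ('C(n, r.-1))%:R < (nu r.-1 G)%:R)
      @[n --> \oo] --> (1 : R)).
Proof.
have [c0 [d1 [c00 d10 near_d]]] := hd.
have r1 : (1 < r)%N by apply: ltnW.
have rR : 0 < r%:R :> R by rewrite ltr0n ltnW.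
pose u n : R := (n - r.-1)%:R^-1.
have u_cvg : u n @[n --> \oo] --> (0 : R) by exact: cvg_inv_sub.
have Mu_cvg (M : R) : M * u n @[n --> \oo] --> (0 : R).
  by rewrite -[X in _ --> X](mulr0 M); exact: cvgMl_tmp.
pose c : R := 4 ^+ r + 1.
pose k := (Num.truncn (2 * c * d1)).+1.
have k_ge : 2 * c * d1 <= k%:R.
  have c0' : 0 <= c by rewrite addr_ge0 // exprn_ge0.
  have : 0 <= 2 * c * d1 by rewrite !mulr_ge0 // ltW.
  by move=> /truncn_itv/andP[_ /ltW].
pose e n := 24 * root_iter k ((1 + 2 * r%:R) * u n) + (1 + r%:R / c0) * u n.
have e_cvg : e n @[n --> \oo] --> (0 : R).
  rewrite -[X in _ --> X](addr0 0) -{1}(mulr0 24).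
  by apply: cvgD => //; apply: cvgMl_tmp; apply: cvg_root_iter.
(* The failure probability is at most e / delta^2, so the fourth root of e makes
   both delta and the failure probability tend to 0. *)
pose delta n := root_iter 2 (e n).
have delta_cvg : delta n @[n --> \oo] --> (0 : R) by exact: cvg_root_iter.
have alpha0 := alpha_gt0 r1 c00.
pose K : R := r.-1%:R * d1 + r.-1%:R * r%:R + 1.
have K0 : 0 <= K by rewrite !addr_ge0 // mulr_ge0 // ltW.
(* Dividing by the lower bound alpha r c0 turns an additive loss in the covered
   proportion into a relative one. *)
pose eps n := - (K / alpha r c0) * (delta n + u n).
exists eps; split.
  rewrite -[X in _ --> X](mulr0 (- (K / alpha r c0))) -(addr0 0).
  by apply: cvgMl_tmp; exact: cvgD.
have e_root : 1 - root_iter 1 (e n) @[n --> \oo] --> (1 : R).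
  rewrite -[X in _ --> X](subr0 1); apply: cvgB; first exact: cvg_cst.
  exact: cvg_root_iter.
apply: squeeze_cvgr e_root (cvg_cst (1 : R)).
near=> n.
have /andP[cd dd1] : c0 <= avg_codegree r n (p n) <= d1 by near: n.
have rn : (r <= n)%N by near: n; exact: nbhs_infty_ge.
have dlt1 : delta n < 1 by near: n; apply: (cvgr_lt _ delta_cvg).
have u1 : (1 + 2 * r%:R) * u n <= 1.
  by apply: ltW; near: n; apply: (cvgr_lt _ (Mu_cvg _)).
have u2 : (c * (2 * r%:R)) * u n <= 1.
  by apply: ltW; near: n; apply: (cvgr_lt _ (Mu_cvg _)).
have u3 : d1 * u n <= 2^-1.
  by apply: ltW; near: n; apply: (cvgr_lt _ (Mu_cvg _)); rewrite invr_gt0.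
rewrite H_prob_le1 // andbT.
have D0 : 0 < (n - r.-1)%:R :> R by rewrite ltr0n subn_gt0 prednK // ltnW.
have u0 : 0 < u n by rewrite invr_gt0.
have e0 : 0 < e n.
  apply: ltr_wpDl; last by rewrite mulr_gt0 // addr_gt0 // divr_gt0.
  have x0 : 0 <= (1 + 2 * r%:R) * u n by rewrite mulr_ge0 ?addr_ge0 ?mulr_ge0 // ltW.
  have /andP[x1 _] : (1 + 2 * r%:R) * u n <= root_iter k ((1 + 2 * r%:R) * u n) <= 1.
    by apply: root_iter_bounds; rewrite x0 u1.
  by rewrite mulr_ge0 // (le_trans x0).
have delta0 : 0 < delta n by rewrite !sqrtr_gt0.
have dE : avg_codegree r n (p n) = (n - r.-1)%:R * p n.
  by rewrite /avg_codegree natrB // (leq_trans (leq_pred _)).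
have p_half : p n <= 2^-1.
  apply: le_trans u3; by rewrite /u ler_pdivlMr // mulrC -dE.
have cd1 : c0 <= avg_codegree r n (p n) <= d1 by rewrite cd dd1.
have del1 : 0 < delta n < 1 by rewrite delta0 dlt1.
have u2' : (4 ^+ r + 1) * (2 * r%:R / (n - r.-1)%:R) <= 1 :> R by rewrite mulrA.
have main := matching_prob_explicit r1 rn (hp n) c00 cd1 del1 p_half u1 u2' k_ge.
have sqE : delta n ^+ 2 = root_iter 1 (e n) by rewrite sqr_sqrtr // sqrtr_ge0.
have eE : e n / delta n ^+ 2 = root_iter 1 (e n).
  have s0 : 0 < root_iter 1 (e n) by rewrite sqrtr_gt0.
  rewrite sqE -{1}(sqr_sqrtr (ltW e0)) expr2 mulfK //; exact: lt0r_neq0.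
rewrite -/(e n) eE in main.
apply: le_trans main _; apply: H_prob_mono => // G; apply: le_lt_trans.
set al := alpha r _.
have al_ge : alpha r c0 <= al by apply: alpha_le; rewrite cd ltW.
have -> : (1 + eps n) * (1 / r%:R) * al * 'C(n, r.-1)%:R =
          'C(n, r.-1)%:R / r%:R * ((1 + eps n) * al).
  by rewrite div1r; ring.
apply: ler_wpM2l; first by rewrite divr_ge0.
rewrite mulrDl mul1r lerD2l /eps -/K -/(u n) mulNr mulNr lerN2 mulrAC.
apply: ler_wpM2r; first by rewrite addr_ge0 // ltW.
by rewrite -mulrA mulrC -{1}[K]mul1r ler_wpM2r // mulrC ler_pdivlMr // mul1r.
Unshelve. all: by end_near.
Qed.
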